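(* Let $(G,E,\varphi)$ be a self-similar triple and let $R$ be a unital commutative $*$-ring. Let $\pi\colon L_R(G,E)\to B$ be a $\mathbb{Z}$-graded $*$-algebra homomorphism into a $\mathbb{Z}$-graded $*$-algebra $B$ over $R$, where $L_R(G,E)$ carries the $\mathbb{Z}$-grading described in the context. Suppose that $\pi(a)\neq 0$ for all $a\in \operatorname{span}_R\{p_{v,f}: v\in E^0, f\in G\}\setminus\{0\}$. Then $\pi$ is injective.
   Context: A unital commutative $*$-ring $R$ is a commutative ring with $1$ together with an involution $r\mapsto r^*$. A $*$-algebra over $R$ is an (associative, not necessarily unital) $R$-algebra with a map $a\mapsto a^*$ satisfying $(a^* )^*=a$, $(ab)^*=b^*a^*$, $(ra+b)^*=r^*a^*+b^*$. A projection is $p=p^*=p^2$; a partial isometry is $s=ss^*s$. A directed graph $E=(E^0,E^1,r,s)$ has countable vertex set $E^0$, countable edge set $E^1$ and maps $r,s\colon E^1\to E^0$. It is row-finite if $vE^1:=r^{-1}(v)$ is finite for all $v$, and has no sources if $vE^1\neq\emptyset$ for all $v$. An action of a group $G$ on $E$ is a homomorphism from $G$ to the group of bijections of $E^0\sqcup E^1$ that preserve $E^0$ and $E^1$ and commute with $r$ and $s$; write $g\cdot v$, $g\cdot e$. A self-similar triple $(G,E,\varphi)$: a countable discrete group $G$ (unit $e_G$), a row-finite graph $E$ with no sources, an action of $G$ on $E$, and a map $\varphi\colon G\times E^1\to G$ with $\varphi(gh,e)=\varphi(g,h\cdot e)\varphi(h,e)$ and $\varphi(g,e)\cdot v=g\cdot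 v$ for all $g,h\in G$, $e\in E^1$, $v\in E^0$. An $E$-family in a $*$-algebra: mutually orthogonal projections $P_v$ ($v\in E^0$) and partial isometries $S_e$ ($e\in E^1$) with $S_e^*S_f=\delta_{e,f}P_{s(e)}$ and $P_v=\sum_{e\in vE^1}S_eS_e^*$. A $(G,E)$-family: elements $P_{v,f}$, $S_{e,g}$ ($v\in E^0$, $e\in E^1$, $f,g\in G$) such that (a) $\{P_{v,e_G}\}\cup\{S_{e,e_G}\}$ is an $E$-family; (b) $(P_{v,f})^*=P_{f^{-1}\cdot v,f^{-1}}$; (c) $P_{v,f}P_{w,h}=\delta_{v,f\cdot w}P_{v,fh}$; (d) $P_{v,f}S_{e,g}=\delta_{v,r(f\cdot e)}S_{f\cdot e,\varphi(f,e)g}$; (e) $S_{e,g}P_{v,f}=\delta_{g\cdot v,s(e)}S_{e,gf}$. $L_R(G,E)$ is the universal $*$-algebra over $R$ generated by a $(G,E)$-family $\{p_{v,f},s_{e,g}\}$. Paths: $E^n$ ($n\ge1$) is the set of $\alpha=\alpha_1\cdots\alpha_n$ with $\alpha_i\in E^1$, $s(\alpha_i)=r(\alpha_{i+1})$, $r(\alpha)=r(\alpha_1)$, $s(\alpha)=s(\alpha_n)$, $|\alpha|=n$; vertices are paths of length $0$ with $r(v)=s(v)=v$; $E^*=\bigcup_{n\ge0}E^n$. For $g\in G$ put $s_{\alpha,g}:=s_{\alpha_1,e_G}\cdots s_{\alpha_{n-1},e_G}s_{\alpha_n,g}$ if $n=|\alpha|>0$ and $s_{\alpha,g}:=p_{\alpha,g}$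 if $\alpha\in E^0$. Grading: a $\mathbb{Z}$-graded algebra over $R$ is $A=\bigoplus_{n\in\mathbb{Z}}A_n$ with $R$-submodules $A_n$ and $A_mA_n\subseteq A_{m+n}$; a homomorphism $\pi\colon A\to B$ is graded if $\pi(A_n)\subseteq B_n$ for all $n$. $L_R(G,E)$ is $\mathbb{Z}$-graded with components $A_n=\operatorname{span}_R\{s_{\alpha,g}s_{\beta,e_G}^*:\alpha,\beta\in E^*,\ g\in G,\ s(\alpha)=g\cdot s(\beta),\ |\alpha|-|\beta|=n\}$. *)

(* Defs.v *)
From HB Require Import structures.
From mathcomp Require Import all_boot all_order all_algebra.
From mathcomp Require Import all_classical.

Set Implicit Arguments.
Unset Strict Implicit.
Unset Printing Implicit Defensive.

Import GRing.Theory.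
Local Open Scope classical_set_scope.
Local Open Scope ring_scope.

(* [comPzRingType] rather than [comNzRingType]: the zero ring is allowed.
   [1^* = 1] follows from the axioms. *)
HB.mixin Record isStarRing R of GRing.ComPzRing R := {
  conjr : R -> R;
  conjrK : involutive conjr;
  conjrD : {morph conjr : a b / a + b};
  conjrM : {morph conjr : a b / a * b}
}.

#[short(type="comStarRingType")]
HB.structure Definition ComStarRing := {R of isStarRing R & GRing.ComPzRing R}.

(* The ring structures of MathComp are unital, so the multiplication of a
   not necessarily unital algebra is added on top of a module structure. *)
HB.mixin Record Lmodule_isStarAlgebra (R : comStarRingType) A
    of GRing.Lmodule R A := {
  amul : A -> A -> A;
  astar : A -> A;
  amulA : associative amul;
  amulDl : left_distributive amul +%R;
  amulDr : right_distributive amul +%R;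
  amulZl : forall (r : R) (a b : A), amul (r *: a) b = r *: amul a b;
  amulZr : forall (r : R) (a b : A), amul a (r *: b) = r *: amul a b;
  astarK : involutive astar;
  astarM : forall a b : A, astar (amul a b) = amul (astar b) (astar a);
  astar_linear : forall (r : R) (a b : A),
    astar (r *: a + b) = conjr r *: astar a + astar b
}.

#[short(type="starAlgType")]
HB.structure Definition StarAlgebra (R : comStarRingType) :=
  {A of Lmodule_isStarAlgebra R A & GRing.Lmodule R A}.

Notation "a ** b" := (amul a b) (at level 40, left associativity) : ring_scope.
Notation "a ^†" := (astar a) (at level 2, format "a ^†") : ring_scope.

Section StarAlgebraNotions.
Variables (R : comStarRingType) (A : starAlgType R).

Definition projection (p : A) := p = p^† /\ p = p ** p.

Definition partial_isometry (s : A) := s = s ** s^† ** s.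

Definition submodule (D : set A) :=
  D 0 /\ forall (r : R) (a b : A), D a -> D b -> D (r *: a + b).

Definition star_subalgebra (D : set A) :=
  [/\ submodule D,
      forall a b, D a -> D b -> D (a ** b)
    & forall a, D a -> D a^†].

Definition lspan (X : set A) : set A :=
  [set a | exists n (c : 'I_n -> R) (x : 'I_n -> A),
     (forall i, X (x i)) /\ a = \sum_(i < n) c i *: x i].

(* [A] is the internal direct sum of the submodules [A_ n], and
   [A_ m ** A_ n] is contained in [A_ (m + n)]. *)
Record Zgrading (A_ : int -> set A) : Prop := {
  Zgrading_submodule : forall n, submodule (A_ n);
  Zgrading_mul : forall m n a b, A_ m a -> A_ n b -> A_ (m + n) (a ** b);
  Zgrading_sum : forall a, exists (t : seq int) (c : int -> A),
    [/\ uniq t, forall n, A_ n (c n) & a = \sum_(n <- t) c n];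
  Zgrading_direct : forall (t : seq int) (c : int -> A),
    uniq t -> (forall n, A_ n (c n)) -> \sum_(n <- t) c n = 0 ->
    forall n, n \in t -> c n = 0
}.

End StarAlgebraNotions.

Definition star_hom (R : comStarRingType) (A B : starAlgType R)
    (h : {linear A -> B}) :=
  {morph h : a b / a ** b} /\ {morph h : a / a^†}.

Definition graded_map (R : comStarRingType) (A B : starAlgType R)
    (A_ : int -> set A) (B_ : int -> set B) (h : A -> B) :=
  forall n a, A_ n a -> B_ n (h a).

Record digraph := Digraph {
  vertex : countType;
  edge : countType;
  rng : edge -> vertex;
  src : edge -> vertex
}.

Definition row_finite (E : digraph) :=
  forall v : vertex E, finite_set [set e : edge E | rng e = v].

Definition no_sources (E : digraph) :=
  forall v : vertex E, [set e : edge E | rng e = v] !=set0.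

Record self_similar_triple := SelfSimilarTriple {
  grp : groupType;
  grp_countable : countable [set: grp];
  grf : digraph;
  grf_row_finite : row_finite grf;
  grf_no_sources : no_sources grf;
  actv : grp -> vertex grf -> vertex grf;
  acte : grp -> edge grf -> edge grf;
  actv1 : forall v, actv 1%g v = v;
  acte1 : forall e, acte 1%g e = e;
  actvM : forall g h v, actv (g * h)%g v = actv g (actv h v);
  acteM : forall g h e, acte (g * h)%g e = acte g (acte h e);
  rng_act : forall g e, rng (acte g e) = actv g (rng e);
  src_act : forall g e, src (acte g e) = actv g (src e);
  cocycle : grp -> edge grf -> grp;
  cocycleM : forall g h e,
    cocycle (g * h)%g e = (cocycle g (acte h e) * cocycle h e)%g;
  cocycle_actv : forall g e v, actv (cocycle g e) v = actv g v
}.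

Section Families.
Variables (R : comStarRingType) (T : self_similar_triple).

Local Notation G := (grp T).
Local Notation E0 := (vertex (grf T)).
Local Notation E1 := (edge (grf T)).

(* In the families below the Kronecker deltas are written [x *+ (b : bool)]. *)
Record E_family (A : starAlgType R) (P : E0 -> A) (S : E1 -> A) : Prop := {
  E_projection : forall v, projection (P v);
  E_orthogonal : forall v w, v != w -> P v ** P w = 0;
  E_partial_isometry : forall e, partial_isometry (S e);
  E_starS : forall e f, (S e)^† ** S f = P (src e) *+ (e == f);
  E_sum : forall v, P v = \sum_(e \in [set e | rng e = v]) S e ** (S e)^†
}.

Record GE_family (A : starAlgType R) (P : E0 -> G -> A) (S : E1 -> G -> A)
    : Prop := {
  GE_E_family : E_family (P ^~ 1%g) (S ^~ 1%g);
  GE_starP : forall v f, (P v f)^† = P (actv f^-1%g v) f^-1%g;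
  GE_mulPP : forall v f w h,
    P v f ** P w h = P v (f * h)%g *+ (v == actv f w);
  GE_mulPS : forall v f e g,
    P v f ** S e g =
      S (acte f e) (cocycle f e * g)%g *+ (v == rng (acte f e));
  GE_mulSP : forall e g v f,
    S e g ** P v f = S e (g * f)%g *+ (actv g v == src e)
}.

(* [L] is the algebra L_R(G,E), with generating family [p], [s].  Uniqueness of
   the lift follows from [universal_generated]. *)
Record universal_GE_family (L : starAlgType R) (p : E0 -> G -> L)
    (s : E1 -> G -> L) : Prop := {
  universal_family : GE_family p s;
  universal_generated : forall D : set L, star_subalgebra D ->
    (forall v g, D (p v g)) -> (forall e g, D (s e g)) -> forall a, D a;
  universal_lift : forall (B : starAlgType R) (P : E0 -> G -> B)
      (S : E1 -> G -> B), GE_family P S ->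
    exists h : {linear L -> B}, [/\ star_hom h,
      forall v g, h (p v g) = P v g & forall e g, h (s e g) = S e g]
}.

(* [Evert v] is the path of length 0 at [v]; [Eseq e t] is the sequence of
   edges [e :: t], a path when it satisfies [is_path]. *)
Inductive epath := Evert of E0 | Eseq of E1 & seq E1.

Definition is_path (a : epath) : bool :=
  if a is Eseq e t then path (fun e f => src e == rng f) e t else true.

Definition psrc (a : epath) : E0 :=
  match a with Evert v => v | Eseq e t => src (last e t) end.

Definition plen (a : epath) : nat :=
  if a is Eseq _ t then (size t).+1 else 0%N.

Section Spanning.
Variables (L : starAlgType R) (p : E0 -> G -> L) (s : E1 -> G -> L).

Fixpoint s_word (e : E1) (t : seq E1) (g : G) : L :=
  if t is f :: t' then s e 1%g ** s_word f t' g else s e g.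

Definition s_path (a : epath) (g : G) : L :=
  match a with Evert v => p v g | Eseq e t => s_word e t g end.

Definition GE_component (n : int) : set L :=
  lspan [set x | exists (a b : epath) (g : G),
    [/\ is_path a, is_path b, psrc a = actv g (psrc b),
        (plen a)%:Z - (plen b)%:Z = n
      & x = s_path a g ** (s_path b 1%g)^†]].

Definition p_span : set L := lspan [set x | exists v f, x = p v f].

End Spanning.
End Families.

(* Non-vacuity of [universal_GE_family]: L_R(G,E) is built as the quotient of
   the *-algebra terms by the equations valid in every (G,E)-family. *)
Module LGEConstruction.
Section Existence.
Variables (R : comStarRingType) (T : self_similar_triple).

Local Notation G := (grp T).
Local Notation E0 := (vertex (grf T)).
Local Notation E1 := (edge (grf T)).

Inductive term :=
  | Tp of E0 & G | Ts of E1 & G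
  | T0 | Tadd of term & term | Tscale of R & term
  | Tmul of term & term | Tstar of term.

HB.instance Definition _ := gen_eqMixin term.
HB.instance Definition _ := gen_choiceMixin term.

Fixpoint teval (B : starAlgType R) (P : E0 -> G -> B) (S : E1 -> G -> B)
    (t : term) : B :=
  match t with
  | Tp v g => P v g
  | Ts e g => S e g
  | T0 => 0
  | Tadd t u => teval P S t + teval P S u
  | Tscale r t => r *: teval P S t
  | Tmul t u => teval P S t ** teval P S u
  | Tstar t => (teval P S t)^†
  end.

Definition teq (t u : term) : bool :=
  `[< forall (B : starAlgType R) (P : E0 -> G -> B) (S : E1 -> G -> B),
        GE_family P S -> teval P S t = teval P S u >].

Lemma teq_refl : reflexive teq.
Proof. by move=> t; apply/asboolP. Qed.

Lemma teq_sym : symmetric teq.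
Proof.
by move=> t u; apply/asboolP/asboolP => H B P S F; rewrite H.
Qed.

Lemma teq_trans : transitive teq.
Proof.
move=> t u v /asboolP H1 /asboolP H2; apply/asboolP => B P S F.
by rewrite H1 // H2.
Qed.

Canonical teq_equiv := EquivRel teq teq_refl teq_sym teq_trans.

Definition LGE := {eq_quot teq}%qT.
HB.instance Definition _ := Choice.on LGE.

Definition leval (B : starAlgType R) (P : E0 -> G -> B) (S : E1 -> G -> B)
    (x : LGE) : B := teval P S (repr x).

Lemma levalE B P S t : GE_family P S ->
  @leval B P S (\pi_LGE t)%qT = teval P S t.
Proof.
move=> F; have /asboolP : teq (repr (\pi_LGE t)%qT) t.
  by apply/eqmodP; rewrite reprK.
exact.
Qed.

Lemma leval_inj (x y : LGE) :
  (forall (B : starAlgType R) (P : E0 -> G -> B) (S : E1 -> G -> B),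
     GE_family P S -> leval P S x = leval P S y) -> x = y.
Proof.
by move=> H; rewrite -[x]reprK -[y]reprK; apply/eqmodP/asboolP.
Qed.

Definition l0 : LGE := (\pi_LGE T0)%qT.
Definition ladd (x y : LGE) : LGE := (\pi_LGE (Tadd (repr x) (repr y)))%qT.
Definition lscale r (x : LGE) : LGE := (\pi_LGE (Tscale r (repr x)))%qT.
Definition lopp (x : LGE) : LGE := lscale (-1) x.
Definition lmul (x y : LGE) : LGE := (\pi_LGE (Tmul (repr x) (repr y)))%qT.
Definition lstar (x : LGE) : LGE := (\pi_LGE (Tstar (repr x)))%qT.

Section Eval.
Variables (B : starAlgType R) (P : E0 -> G -> B) (S : E1 -> G -> B).
Hypothesis F : GE_family P S.
Lemma leval0 : leval P S l0 = 0. Proof. exact: levalE. Qed.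
Lemma levalD x y : leval P S (ladd x y) = leval P S x + leval P S y.
Proof. exact: levalE. Qed.
Lemma levalZ r x : leval P S (lscale r x) = r *: leval P S x.
Proof. exact: levalE. Qed.
Lemma levalN x : leval P S (lopp x) = - leval P S x.
Proof. by rewrite levalZ scaleN1r. Qed.
Lemma levalM x y : leval P S (lmul x y) = leval P S x ** leval P S y.
Proof. exact: levalE. Qed.
Lemma leval_star x : leval P S (lstar x) = (leval P S x)^†.
Proof. exact: levalE. Qed.
Definition leval_ops := (leval0, levalD, levalN, levalZ, levalM, leval_star).
End Eval.

Lemma laddA : associative ladd.
Proof. by move=> x y z; apply: leval_inj => B P S F; rewrite !(leval_ops F) addrA. Qed.
Lemma laddC : commutative ladd.
Proof. by move=> x y; apply: leval_inj => B P S F; rewrite !(leval_ops F) addrC. Qed.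
Lemma ladd0 : left_id l0 ladd.
Proof. by move=> x; apply: leval_inj => B P S F; rewrite !(leval_ops F) add0r. Qed.
Lemma laddN : left_inverse l0 lopp ladd.
Proof. by move=> x; apply: leval_inj => B P S F; rewrite !(leval_ops F) addNr. Qed.

HB.instance Definition _ := GRing.isZmodule.Build LGE laddA laddC ladd0 laddN.

Lemma lscaleA a b x : lscale a (lscale b x) = lscale (a * b) x.
Proof. by apply: leval_inj => B P S F; rewrite !(leval_ops F) scalerA. Qed.
Lemma lscale1 : left_id 1 lscale.
Proof. by move=> x; apply: leval_inj => B P S F; rewrite !(leval_ops F) scale1r. Qed.
Lemma lscaleDr : right_distributive lscale +%R.
Proof. by move=> r x y; apply: leval_inj => B P S F; rewrite !(leval_ops F) scalerDr. Qed.
Lemma lscaleDl x : {morph lscale^~ x : a b / a + b}.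
Proof. by move=> a b; apply: leval_inj => B P S F; rewrite !(leval_ops F) scalerDl. Qed.

HB.instance Definition _ := GRing.Zmodule_isLmodule.Build R LGE
  lscaleA lscale1 lscaleDr lscaleDl.

Lemma lmulA : associative lmul.
Proof. by move=> x y z; apply: leval_inj => B P S F; rewrite !(leval_ops F) amulA. Qed.
Lemma lmulDl : left_distributive lmul +%R.
Proof. by move=> x y z; apply: leval_inj => B P S F; rewrite !(leval_ops F) amulDl. Qed.
Lemma lmulDr : right_distributive lmul +%R.
Proof. by move=> x y z; apply: leval_inj => B P S F; rewrite !(leval_ops F) amulDr. Qed.
Lemma lmulZl (r : R) (a b : LGE) : lmul (r *: a) b = r *: lmul a b.
Proof. by apply: leval_inj => B P S F; rewrite !(leval_ops F) amulZl. Qed.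
Lemma lmulZr (r : R) (a b : LGE) : lmul a (r *: b) = r *: lmul a b.
Proof. by apply: leval_inj => B P S F; rewrite !(leval_ops F) amulZr. Qed.
Lemma lstarK : involutive lstar.
Proof. by move=> x; apply: leval_inj => B P S F; rewrite !(leval_ops F) astarK. Qed.
Lemma lstarM a b : lstar (lmul a b) = lmul (lstar b) (lstar a).
Proof. by apply: leval_inj => B P S F; rewrite !(leval_ops F) astarM. Qed.
Lemma lstar_linear (r : R) (a b : LGE) :
  lstar (r *: a + b) = conjr r *: lstar a + lstar b.
Proof. by apply: leval_inj => B P S F; rewrite !(leval_ops F) astar_linear. Qed.

HB.instance Definition _ := Lmodule_isStarAlgebra.Build R LGE
  lmulA lmulDl lmulDr lmulZl lmulZr lstarK lstarM lstar_linear.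

Definition lp (v : E0) (g : G) : LGE := (\pi_LGE (Tp v g))%qT.
Definition ls (e : E1) (g : G) : LGE := (\pi_LGE (Ts e g))%qT.

Section Lift.
Variables (B : starAlgType R) (P : E0 -> G -> B) (S : E1 -> G -> B).
Hypothesis F : GE_family P S.
Lemma leval_additive : {morph leval P S : x y / x - y}.
Proof. by move=> x y; rewrite !(leval_ops F). Qed.
Lemma leval_scalable : scalable (leval P S).
Proof. by move=> r x; rewrite !(leval_ops F). Qed.
Lemma leval_lin : exists h : {linear LGE -> B}, h =1 leval P S.
Proof.
pose a := GRing.isZmodMorphism.Build LGE B (leval P S) leval_additive.
pose b := GRing.isScalable.Build R LGE B *:%R (leval P S) leval_scalable.
pose h : {linear LGE -> B} := HB.pack (leval P S) a b.
by exists h.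
Qed.
Lemma leval_mulrb x (b : bool) : leval P S (x *+ b) = leval P S x *+ b.
Proof. by case: b; rewrite ?(leval_ops F). Qed.
Lemma leval_sum (I : Type) (r : seq I) (X : I -> LGE) :
  leval P S (\sum_(i <- r) X i) = \sum_(i <- r) leval P S (X i).
Proof. by have [h hE] := leval_lin; rewrite -hE raddf_sum; apply: eq_bigr => i _; exact: hE. Qed.
Lemma leval_p v g : leval P S (lp v g) = P v g. Proof. exact: levalE. Qed.
Lemma leval_s e g : leval P S (ls e g) = S e g. Proof. exact: levalE. Qed.
Definition lE := (leval_mulrb, leval_p, leval_s, leval_ops F).
End Lift.

Lemma lGE_family : GE_family lp ls.
Proof.
split; first split.
- move=> v; split; apply: leval_inj => B P S F; rewrite !(lE F);
  by case: (E_projection (GE_E_family F) v).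
- move=> v w vw; apply: leval_inj => B P S F; rewrite !(lE F).
  exact: (E_orthogonal (GE_E_family F)).
- move=> e; apply: leval_inj => B P S F; rewrite !(lE F).
  exact: (E_partial_isometry (GE_E_family F)).
- move=> e f; apply: leval_inj => B P S F; rewrite !(lE F).
  exact: (E_starS (GE_E_family F)).
- move=> v; apply: leval_inj => B P S F; rewrite (leval_p F).
  rewrite (E_sum (GE_E_family F)) !fsbig_finite /=; [|exact: grf_row_finite..].
  by rewrite (leval_sum F); apply: eq_bigr => e _; rewrite !(lE F).
- by move=> *; apply: leval_inj => B P S F; rewrite !(lE F) (GE_starP F).
- by move=> *; apply: leval_inj => B P S F; rewrite !(lE F) (GE_mulPP F).
- by move=> *; apply: leval_inj => B P S F; rewrite !(lE F) (GE_mulPS F).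
- by move=> *; apply: leval_inj => B P S F; rewrite !(lE F) (GE_mulSP F).
Qed.

Theorem universal_GE_family_exists :
  exists (L : starAlgType R) (p : E0 -> G -> L) (s : E1 -> G -> L),
    universal_GE_family p s.
Proof.
exists LGE, lp, ls; split; first exact: lGE_family.
- move=> D [[D0 DZD] DM Dstar] Dp Ds a; rewrite -[a]reprK.
  pose q t : LGE := (\pi_LGE t)%qT; rewrite -/(q (repr a)).
  have qE t : q t = match t with
    | Tp v g => lp v g | Ts e g => ls e g | T0 => 0
    | Tadd t u => 1 *: q t + q u
    | Tscale r t => r *: q t + 0
    | Tmul t u => q t ** q u
    | Tstar t => (q t)^† end.
    case: t => // *; rewrite ?scale1r ?addr0; apply: leval_inj => B P S F;
    by rewrite ?(lE F) !(levalE _ F).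
  elim: (repr a) => [v g|e g||t Dt u Du|r t Dt|t Dt u Du|t Dt]; rewrite qE //.
  + exact: DZD.
  + exact: DZD.
  + exact: DM.
  + exact: Dstar.
- move=> B P S F; have [h hE] := leval_lin F.
  exists h; split; first split.
  + by move=> x y; rewrite !hE (levalM F).
  + by move=> x; rewrite !hE (leval_star F).
  + by move=> v g; rewrite hE (leval_p F).
  + by move=> e g; rewrite hE (leval_s F).
Qed.

End Existence.
End LGEConstruction.

(* Main.v *)
(** The grading of [B] reduces everything to one homogeneous element.
    Row-finiteness gives [p v g = \sum_e s_e s_e^* p v g], so an element of
    degree [n] can be written with paths of common lengths [m] and [k],
    [m - k = n]; let [bideg m k] be the span of these.  If [a] lies in
    [bideg m.+1 k] and [pi a = 0], then each [s_e^* a] lies in [bideg m k] and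
    in the kernel of [pi], so it vanishes by induction on [m], and [a] is a
    finite sum of terms [s_e s_e^* a].  The involution exchanges [m] and [k],
    and the hypothesis on [pi] settles [bideg 0 0], the span of the [p v f]. *)
Require Import Defs.
From HB Require Import structures.
From mathcomp Require Import all_boot all_order all_algebra.
From mathcomp Require Import all_classical.
From mathcomp Require Import zify.

Set Implicit Arguments.
Unset Strict Implicit.
Unset Printing Implicit Defensive.

Import GRing.Theory.
Local Open Scope classical_set_scope.
Local Open Scope ring_scope.

(** * Arithmetic, submodules and spans in a non-unital *-algebra *)

Section StarAlgebraTheory.
Variables (R : comStarRingType) (A : starAlgType R).
Implicit Types (r : R) (a b : A) (X M : set A).

Lemma conjr1 : conjr (1 : R) = 1.
Proof. by have := conjrM (conjr (1 : R)) 1; rewrite mulr1 conjrK mul1r. Qed.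

Lemma astarD a b : (a + b)^† = a^† + b^†.
Proof. by have := astar_linear 1 a b; rewrite conjr1 !scale1r. Qed.

Lemma astar0 : (0 : A)^† = 0.
Proof. by apply: (@addrI _ (0 : A)^†); rewrite -astarD !addr0. Qed.

Lemma astarZ r a : (r *: a)^† = conjr r *: a^†.
Proof. by have := astar_linear r a 0; rewrite astar0 !addr0. Qed.

Lemma astarMb a (c : bool) : (a *+ c)^† = a^† *+ c.
Proof. by case: c => //=; rewrite astar0. Qed.

Lemma amul0r a : 0 ** a = 0.
Proof. by apply: (@addrI _ (0 ** a)); rewrite -amulDl !addr0. Qed.

Lemma amulr0 a : a ** 0 = 0.
Proof. by apply: (@addrI _ (a ** 0)); rewrite -amulDr !addr0. Qed.

Lemma amulMbl a b (c : bool) : (a *+ c) ** b = (a ** b) *+ c.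
Proof. by case: c => //=; rewrite amul0r. Qed.

Lemma amulMbr a b (c : bool) : a ** (b *+ c) = (a ** b) *+ c.
Proof. by case: c => //=; rewrite amulr0. Qed.

Lemma amul_suml (I : Type) (t : seq I) (F : I -> A) a :
  (\sum_(i <- t) F i) ** a = \sum_(i <- t) F i ** a.
Proof. by apply: (big_morph (amul^~ a)) => [x y|]; rewrite ?amulDl ?amul0r. Qed.

Lemma amul_sumr (I : Type) (t : seq I) (F : I -> A) a :
  a ** (\sum_(i <- t) F i) = \sum_(i <- t) a ** F i.
Proof. by apply: (big_morph (amul a)) => [x y|]; rewrite ?amulDr ?amulr0. Qed.

Lemma submoduleD M a b : submodule M -> M a -> M b -> M (a + b).
Proof. by move=> [_ MZD] Ma Mb; rewrite -[a]scale1r; apply: MZD. Qed.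

Lemma submoduleZ M r a : submodule M -> M a -> M (r *: a).
Proof. by move=> [M0 MZD] Ma; rewrite -[_ *: _]addr0; apply: MZD. Qed.

Lemma submodule_sum M (I : eqType) (t : seq I) (F : I -> A) :
  submodule M -> (forall i, i \in t -> M (F i)) -> M (\sum_(i <- t) F i).
Proof.
move=> sM MF; rewrite big_seq; elim/big_ind: _ => //; first by case: sM.
by move=> x y; apply: submoduleD.
Qed.

Lemma lspan_gen X a : X a -> lspan X a.
Proof.
move=> Xa; exists 1%N, (fun=> 1), (fun=> a); split => //.
by rewrite big_ord1 scale1r.
Qed.

Lemma lspan_submodule X : submodule (lspan X).
Proof.
split=> [|r a b [m [c [x [Xx ->]]]] [n [d [y [Yy ->]]]]].
  exists 0%N, (fun=> 0), (fun=> 0); split; first by case.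
  by rewrite big_ord0.
exists (m + n)%N,
  (fun i : 'I_(m + n) =>
     match fintype.split i with inl j => r * c j | inr j => d j end),
  (fun i : 'I_(m + n) =>
     match fintype.split i with inl j => x j | inr j => y j end); split.
  by move=> i; case: (fintype.split i).
rewrite big_split_ord scaler_sumr /=; congr (_ + _); apply: eq_bigr => i _.
  by rewrite (unsplitK (inl _ i)) scalerA.
by rewrite (unsplitK (inr _ i)).
Qed.

Lemma lspan_min X M : submodule M -> X `<=` M -> lspan X `<=` M.
Proof.
move=> sM XM _ [n [c [x [Xx ->]]]]; apply: submodule_sum => // i _.
by apply: submoduleZ; last exact: XM.
Qed.

Lemma preim_mull_submodule M a : submodule M -> submodule [set x | M (a ** x)].
Proof.
move=> sM; split=> [|r x y] /=; first by rewrite amulr0; case: sM.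
by move=> Mx My; rewrite amulDr amulZr; case: sM => _; apply.
Qed.

Lemma preim_mulr_submodule M a : submodule M -> submodule [set x | M (x ** a)].
Proof.
move=> sM; split=> [|r x y] /=; first by rewrite amul0r; case: sM.
by move=> Mx My; rewrite amulDl amulZl; case: sM => _; apply.
Qed.

End StarAlgebraTheory.

(** * The bidegree spans of a (G,E)-family *)

Section GEFamily.
Variables (R : comStarRingType) (T : self_similar_triple).
Variables (L : starAlgType R).
Variables (p : vertex (grf T) -> grp T -> L) (s : edge (grf T) -> grp T -> L).
Hypothesis F : GE_family p s.

Local Notation G := (grp T).
Local Notation E0 := (vertex (grf T)).
Local Notation E1 := (edge (grf T)).
Implicit Types (v : E0) (e f : E1) (g h : G) (m k : nat) (x y a : L).

Let FE := GE_E_family F.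

Lemma s_mulp e v g : s e 1%g ** p v g = s e g *+ (v == src e).
Proof. by rewrite (GE_mulSP F) actv1 mul1g. Qed.

(** Moves the group element into a vertex factor, so that [bideg] only has to multiply by edges
    [s e 1]. *)
Lemma s_split e g : s e g = s e 1%g ** p (src e) g.
Proof. by rewrite s_mulp eqxx. Qed.

Lemma star_s_split e g :
  (s e g)^† = p (actv g^-1%g (src e)) g^-1%g ** (s e 1%g)^†.
Proof. by rewrite s_split astarM (GE_starP F). Qed.

Lemma p1_mul v g : p v 1%g ** p v g = p v g.
Proof. by rewrite (GE_mulPP F) actv1 eqxx mul1g. Qed.

(** Edges are attached one at a time with no composability condition, since non-composable products
    vanish. The group element sits in the middle factor [p v g]. *)
Inductive bideg : nat -> nat -> set L :=
| bideg0 m k : bideg m k 0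
| bidegZD m k r x y : bideg m k x -> bideg m k y -> bideg m k (r *: x + y)
| bideg_p v g : bideg 0 0 (p v g)
| bideg_sl m k e x : bideg m k x -> bideg m.+1 k (s e 1%g ** x)
| bideg_sr m k e x : bideg m k x -> bideg m k.+1 (x ** (s e 1%g)^†).

Lemma bideg_submodule m k : submodule (bideg m k).
Proof. by split; [exact: bideg0|move=> *; exact: bidegZD]. Qed.

Lemma bidegMb m k x (c : bool) : bideg m k x -> bideg m k (x *+ c).
Proof. by case: c => //= _; exact: bideg0. Qed.

Lemma bideg_star m k x : bideg m k x -> bideg k m x^†.
Proof.
elim=> {m k x} [m k|m k r x y _ ? _ ?|v g|m k e x _ ?|m k e x _ ?].
- by rewrite astar0; exact: bideg0.
- by rewrite astarD astarZ; exact: bidegZD.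
- by rewrite (GE_starP F); exact: bideg_p.
- by rewrite astarM; exact: bideg_sr.
- by rewrite astarM astarK; exact: bideg_sl.
Qed.

(** Passing [p v g] over an edge [e] leaves the group element [cocycle g e] at another vertex, so
    the induction keeps [v] and [g] general. *)
Lemma bideg_mulp v g m k x : bideg m k x -> bideg m k (p v g ** x).
Proof.
move=> Dx; elim: Dx v g => {m k x}
  [m k|m k r x y _ IHx _ IHy|w h|m k e x _ IH|m k e x _ IH] v g.
- by rewrite amulr0; exact: bideg0.
- by rewrite amulDr amulZr; exact: bidegZD.
- by rewrite (GE_mulPP F); exact/bidegMb/bideg_p.
- rewrite amulA (GE_mulPS F) amulMbl s_split -amulA.
  exact/bidegMb/bideg_sl/IH.
- by rewrite amulA; exact: bideg_sr.
Qed.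

Lemma bideg_star_s_p e v g : bideg 0 1 ((s e 1%g)^† ** p v g).
Proof.
rewrite -[p v g]astarK -astarM (GE_starP F) (GE_mulPS F) astarMb.
by rewrite star_s_split; exact/bidegMb/bideg_sr/bideg_p.
Qed.

(** If [m > 0], [s_e^*] meets an edge on the left and the two collapse to a vertex projection or to
    0. If [m = 0] it passes through the middle factor and adds an edge on the right; the term
    [(m == 0)] records this. *)
Lemma bideg_mul_star_s e m k x :
  bideg m k x -> bideg m.-1 (k + (m == 0)) ((s e 1%g)^† ** x).
Proof.
elim=> {m k x} [m k|m k r x y _ IHx _ IHy|w h|m k f x Dx _|m k f x _ IH].
- by rewrite amulr0; exact: bideg0.
- by rewrite amulDr amulZr; exact: bidegZD.
- exact: bideg_star_s_p.
- by rewrite addn0 amulA (E_starS FE) amulMbl; exact/bidegMb/bideg_mulp.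
- by rewrite amulA; exact: bideg_sr.
Qed.

Lemma bideg_S m k x : bideg m k x -> bideg m.+1 k.+1 x.
Proof.
elim=> {m k x} [m k|m k r x y _ IHx _ IHy|v g|m k f x _ IH|m k f x _ IH].
- exact: bideg0.
- exact: bidegZD.
- rewrite -p1_mul (E_sum FE) fsbig_finite /=; last exact: grf_row_finite.
  rewrite amul_suml; apply: submodule_sum => [|e _]; first exact: bideg_submodule.
  by rewrite -amulA; exact/bideg_sl/bideg_star_s_p.
- exact: bideg_sl.
- exact: bideg_sr.
Qed.

Lemma bideg_addn n m k x : bideg m k x -> bideg (n + m) (n + k) x.
Proof. by move=> Dx; elim: n => //= n IH; rewrite !addSn; exact: bideg_S. Qed.

(** The zero indices are stated as equations so that the induction runs over general [m] and [k]. *)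
Lemma bideg_p_span m k x : bideg m k x -> m = 0 -> k = 0 -> p_span p x.
Proof.
elim=> {m k x} // [m k _ _|m k r x y _ IHx _ IHy m0 k0|v g _ _].
- exact: (lspan_submodule _).1.
- by apply: (lspan_submodule _).2; [exact: IHx|exact: IHy].
- by apply: lspan_gen; exists v, g.
Qed.

(* Quantifying over all larger lists makes the property additive in [x]. *)
Lemma bideg_sum_ss m k x : bideg m k x -> (0 < m)%N ->
  exists t : seq E1, forall u, uniq u -> {subset t <= u} ->
    x = (\sum_(e <- u) s e 1%g ** (s e 1%g)^†) ** x.
Proof.
elim=> {m k x} // [m k _|m k r x y _ IHx _ IHy m0|m k f x _ _ _|m k f x _ IH m0].
- by exists [::] => u _ _; rewrite amulr0.
- have [t Ht] := IHx m0; have [t' Ht'] := IHy m0.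
  exists (t ++ t') => u uu tu; rewrite amulDr amulZr -Ht // -?Ht' //.
    by move=> e et; apply: tu; rewrite mem_cat et orbT.
  by move=> e et; apply: tu; rewrite mem_cat et.
- exists [:: f] => u uu /(_ f); rewrite inE eqxx => /(_ isT) fu.
  rewrite amul_suml (bigD1_seq f) //= big1 ?addr0 => [|e ef].
    by rewrite [_ ** (_ ** x)]amulA -(E_partial_isometry FE).
  rewrite amulA -[_ ** s f 1%g]amulA (E_starS FE) (negbTE ef).
  by rewrite amulr0 amul0r.
- by have [t Ht] := IH m0; exists t => u uu tu; rewrite amulA -Ht.
Qed.

(** * Decomposition of every element into homogeneous ones *)

Definition homogeneous (n : int) : set L :=
  [set x | exists m k, m%:Z - k%:Z = n /\ bideg m k x].

Lemma homogeneous_submodule n : submodule (homogeneous n).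
Proof.
split=> [|r x y [m [k [mk Dx]]] [m' [k' [mk' Dy]]]].
  case: n => n; first by exists n, 0%N; split; [rewrite subr0|exact: bideg0].
  by exists 0%N, n.+1; split; [rewrite sub0r NegzE|exact: bideg0].
(* Both summands are raised to one bidegree: [m - k = m' - k'] gives [m' + k = m + k']. *)
exists (m' + m)%N, (m' + k)%N; split; first lia.
apply: bidegZD; first exact: bideg_addn.
have -> : (m' + m = m + m')%N by lia.
have -> : (m' + k = m + k')%N by lia.
exact: bideg_addn.
Qed.

(** Asking for the sum over every list containing [t] forces [c] to vanish off [t], so two
    decompositions add along the concatenated lists. *)
Definition decomposable : set L :=
  [set x | exists c : int -> L, (forall n, homogeneous n (c n)) /\
     exists t : seq int, forall u, uniq u -> {subset t <= u} ->
       x = \sum_(n <- u) c n].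

Lemma decomposable_submodule : submodule decomposable.
Proof.
split=> [|r x y [c [Hc [t Ht]]] [d [Hd [t' Ht']]]].
  exists (fun=> 0); split; first by move=> n; case: (homogeneous_submodule n).
  by exists [::] => u _ _; rewrite big1.
exists (fun n => r *: c n + d n); split.
  by move=> n; case: (homogeneous_submodule n) => _; apply.
exists (t ++ t') => u uu tu; rewrite big_split -scaler_sumr /= -Ht // -?Ht' //.
  by move=> n nt; apply: tu; rewrite mem_cat nt orbT.
by move=> n nt; apply: tu; rewrite mem_cat nt.
Qed.

Lemma bideg_decomposable m k x : bideg m k x -> decomposable x.
Proof.
move=> Dx; pose n0 := m%:Z - k%:Z.
exists (fun n => x *+ (n == n0)); split.
  move=> n; have [->|_] := eqVneq n n0; first by exists m, k.
  by case: (homogeneous_submodule n).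
exists [:: n0] => u uu /(_ n0); rewrite inE eqxx => /(_ isT) nu.
rewrite (bigD1_seq n0) //= eqxx big1 ?addr0 // => n /negbTE ->.
by rewrite mulr0n.
Qed.

Lemma decomposable_mull y :
  (forall m k x, bideg m k x -> decomposable (y ** x)) ->
  forall x, decomposable x -> decomposable (y ** x).
Proof.
move=> Hy x [c [Hc [t Ht]]]; rewrite (Ht (undup t)) ?undup_uniq //; last first.
  by move=> n; rewrite mem_undup.
rewrite amul_sumr; apply: submodule_sum; first exact: decomposable_submodule.
by move=> n _; have [m [k [_ /Hy]]] := Hc n.
Qed.

(** Left multipliers of the decomposable elements. They are closed under products at once, so only
    generators need checking. As there is no unit, [decomposable a] is asked separately. *)
Definition decomposable_ideal : set L :=
  [set a | decomposable a /\ forall x, decomposable x -> decomposable (a ** x)].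

Lemma decomposable_ideal_submodule : submodule decomposable_ideal.
Proof.
have [D0 DZD] := decomposable_submodule.
split=> [|r a b [Da Ha] [Db Hb]].
  by split=> // x _; rewrite amul0r.
split; first exact: DZD.
by move=> x Dx; rewrite amulDl amulZl; apply: DZD; auto.
Qed.

Lemma decomposable_ideal_mul a b :
  decomposable_ideal a -> decomposable_ideal b -> decomposable_ideal (a ** b).
Proof.
move=> [Da Ha] [Db Hb]; split; first exact: Ha.
by move=> x Dx; rewrite -amulA; apply/Ha/Hb.
Qed.

Lemma decomposable_ideal_p v g : decomposable_ideal (p v g).
Proof.
split; first exact/bideg_decomposable/bideg_p.
apply: decomposable_mull => m k x Dx.
exact/bideg_decomposable/bideg_mulp/Dx.
Qed.

Lemma decomposable_ideal_s e : decomposable_ideal (s e 1%g).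
Proof.
split; first by rewrite s_split; exact/bideg_decomposable/bideg_sl/bideg_p.
apply: decomposable_mull => m k x Dx.
exact/bideg_decomposable/bideg_sl/Dx.
Qed.

Lemma decomposable_ideal_star_s e : decomposable_ideal (s e 1%g)^†.
Proof.
split; first by rewrite star_s_split; exact/bideg_decomposable/bideg_sr/bideg_p.
apply: decomposable_mull => m k x Dx.
exact/bideg_decomposable/bideg_mul_star_s/Dx.
Qed.

Lemma generated_decomposable :
  (forall D : set L, star_subalgebra D ->
    (forall v g, D (p v g)) -> (forall e g, D (s e g)) -> forall a, D a) ->
  forall a, decomposable a.
Proof.
(* Carrying [a^†] along makes the set closed under the involution. *)
move=> gen a; suff [[]] : decomposable_ideal a /\ decomposable_ideal a^† by [].
have [I0 IZD] := decomposable_ideal_submodule.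
apply: (gen [set a | decomposable_ideal a /\ decomposable_ideal a^†]).
- split; first split.
  + by split => //; rewrite astar0.
  + move=> r x y [Ix Ix'] [Iy Iy']; split; first exact: IZD.
    by rewrite astar_linear; exact: IZD.
  + move=> x y [Ix Ix'] [Iy Iy']; split; first exact: decomposable_ideal_mul.
    by rewrite astarM; exact: decomposable_ideal_mul.
  + by move=> x [Ix Ix']; split; rewrite ?astarK.
- move=> v g; split; first exact: decomposable_ideal_p.
  by rewrite (GE_starP F); exact: decomposable_ideal_p.
- move=> e g; split.
    rewrite s_split; apply: decomposable_ideal_mul.
      exact: decomposable_ideal_s.
    exact: decomposable_ideal_p.
  rewrite star_s_split; apply: decomposable_ideal_mul.
    exact: decomposable_ideal_p.
  exact: decomposable_ideal_star_s.
Qed.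

(** * From bidegrees to the path components of the grading *)

Definition prng (a : epath T) : E0 :=
  match a with Evert v => v | Eseq e _ => rng e end.

(** A path of length 0 loses its vertex here, hence the condition [src e = prng a] in
    [psrc_pcons]. *)
Definition pcons e (a : epath T) : epath T :=
  Eseq e (if a is Eseq f t then f :: t else [::]).

Lemma is_path_pcons e (a : epath T) :
  src e = prng a -> is_path a -> is_path (pcons e a).
Proof. by case: a => //= f t ->; rewrite eqxx. Qed.

Lemma psrc_pcons e (a : epath T) : src e = prng a -> psrc (pcons e a) = psrc a.
Proof. by case: a. Qed.

Lemma plen_pcons e (a : epath T) : plen (pcons e a) = (plen a).+1.
Proof. by case: a. Qed.

Lemma s_mul_s_path e (a : epath T) g :
  s e 1%g ** s_path p s a g = s_path p s (pcons e a) g *+ (src e == prng a).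
Proof.
case: a => [v|f t] /=; first by rewrite s_mulp eq_sym.
case: eqVneq => //= ef.
(* With [s f 1] exposed at the front, [p (src e) 1 ** s f 1] vanishes when [src e] differs from
   [rng f]. *)
have [x ->] : exists x, s_word s f t g = s f 1%g ** x.
  case: t => [|f' t] /=; first by exists (p (src f) g); exact: s_split.
  by exists (s_word s f' t g).
rewrite s_split -amulA [p _ _ ** _]amulA (GE_mulPS F) acte1 (negbTE ef).
by rewrite amul0r amulr0.
Qed.

Definition path_span m k : set L :=
  lspan [set x | exists (a b : epath T) g,
    [/\ is_path a, is_path b, psrc a = actv g (psrc b),
        (plen a, plen b) = (m, k)
      & x = s_path p s a g ** (s_path p s b 1%g)^†]].

Lemma path_spanMb m k x (c : bool) :
  (c -> path_span m k x) -> path_span m k (x *+ c).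
Proof.
case: c => [/(_ isT)//|_]; exact: (lspan_submodule _).1.
Qed.

Lemma path_span_sl m k e x :
  path_span m k x -> path_span m.+1 k (s e 1%g ** x).
Proof.
apply: (lspan_min (M := [set y | path_span m.+1 k (s e 1%g ** y)])).
  exact: (preim_mull_submodule _ (lspan_submodule _)).
move=> _ [a [b [g [Pa Pb ab [<- <-] ->]]]] /=.
rewrite amulA s_mul_s_path amulMbl; apply: path_spanMb => /eqP ea.
apply: lspan_gen; exists (pcons e a), b, g.
by rewrite plen_pcons psrc_pcons //; split=> //; exact: is_path_pcons.
Qed.

Lemma path_span_sr m k e x :
  path_span m k x -> path_span m k.+1 (x ** (s e 1%g)^†).
Proof.
apply: (lspan_min (M := [set y | path_span m k.+1 (y ** (s e 1%g)^†)])).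
  exact: (preim_mulr_submodule _ (lspan_submodule _)).
move=> _ [a [b [g [Pa Pb ab [<- <-] ->]]]] /=.
rewrite -amulA -astarM s_mul_s_path astarMb amulMbr.
apply: path_spanMb => /eqP eb.
apply: lspan_gen; exists a, (pcons e b), g.
by rewrite plen_pcons psrc_pcons //; split=> //; exact: is_path_pcons.
Qed.

Lemma bideg_path_span m k x : bideg m k x -> path_span m k x.
Proof.
elim=> {m k x} [m k|m k r x y _ IHx _ IHy|v g|m k e x _|m k e x _].
- exact: (lspan_submodule _).1.
- exact: (lspan_submodule _).2.
(* The second vertex is forced by [psrc a = actv g (psrc b)]. *)
- apply: lspan_gen; exists (Evert v), (Evert (actv g^-1%g v)), g.
  have gv : v = actv g (actv g^-1%g v) by rewrite -actvM mulgV actv1.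
  split=> //=.
  by rewrite (GE_starP F) (GE_mulPP F) invg1 mulg1 actv1 -gv eqxx.
- exact: path_span_sl.
- exact: path_span_sr.
Qed.

Lemma homogeneous_GE_component n : homogeneous n `<=` GE_component p s n.
Proof.
move=> x [m [k [<- /bideg_path_span]]]; apply: (lspan_min (M := GE_component p s _)).
  exact: lspan_submodule.
by move=> _ [a [b [g [? ? ? [<- <-] ->]]]]; apply: lspan_gen; exists a, b, g.
Qed.

(** * Injectivity on each bidegree *)

Section Kernel.
Variables (B : starAlgType R) (pi : {linear L -> B}).
Hypotheses (pi_hom : star_hom pi)
  (pi_p : forall a, p_span p a -> a <> 0 -> pi a <> 0).

Lemma bideg_ker_S m k :
  (forall x, bideg m k x -> pi x = 0 -> x = 0) ->
  forall x, bideg m.+1 k x -> pi x = 0 -> x = 0.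
Proof.
move=> inj x Dx pix; have [t Ht] := bideg_sum_ss Dx isT.
rewrite (Ht (undup t)) ?undup_uniq //; last by move=> e; rewrite mem_undup.
rewrite amul_suml big1 // => e _; rewrite -amulA (inj (_ ** x)) ?amulr0 //.
  by have := bideg_mul_star_s e Dx; rewrite addn0.
by rewrite pi_hom.1 pix amulr0.
Qed.

Lemma bideg_ker m k x : bideg m k x -> pi x = 0 -> x = 0.
Proof.
have inj00 y : bideg 0 0 y -> pi y = 0 -> y = 0.
  move=> Dy piy; apply: contrapT => y0.
  exact: (pi_p (bideg_p_span Dy erefl erefl) y0).
have inj_m0 n y : bideg n 0 y -> pi y = 0 -> y = 0.
  by elim: n y => // n IH; exact: bideg_ker_S.
elim: m x => [x Dx pix|m IH]; last exact: bideg_ker_S.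
(* Bidegree [(0, k)] is reached from [(k, 0)] by the involution. *)
rewrite -[x]astarK (inj_m0 k x^†) ?astar0 //; first exact: bideg_star.
by rewrite pi_hom.2 pix astar0.
Qed.

End Kernel.

End GEFamily.

Theorem theoremA (R : comStarRingType) (T : self_similar_triple)
    (L : starAlgType R)
    (p : vertex (grf T) -> grp T -> L) (s : edge (grf T) -> grp T -> L)
    (hL : universal_GE_family p s)
    (B : starAlgType R) (B_ : int -> set B) (hB : Zgrading B_)
    (pi : {linear L -> B}) (pi_hom : star_hom pi)
    (pi_graded : graded_map (GE_component p s) B_ pi)
    (pi_p : forall a : L, p_span p a -> a <> 0 -> pi a <> 0) :
  injective pi.
Proof.
have F := universal_family hL.
apply: raddf_inj => a pia.
have [c [Hc [t Ht]]] := generated_decomposable F (universal_generated hL) a.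
have {Ht} aE : a = \sum_(n <- undup t) c n.
  by apply: Ht; [exact: undup_uniq|move=> n; rewrite mem_undup].
rewrite aE big_seq big1 // => n nt; have [m [k [_ Dc]]] := Hc n.
apply: (bideg_ker F pi_hom pi_p Dc).
(* The images [pi (c n)] lie in distinct components of [B] and sum to [pi a = 0], so each is
   zero. *)
apply: (Zgrading_direct hB (undup_uniq t) (c := pi \o c)) nt => [i|] /=.
  exact/pi_graded/homogeneous_GE_component/Hc.
by rewrite -raddf_sum -aE.
Qed.
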